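(* Let $Q\in\mathcal B$. Suppose $\Lambda$ is an ergodic probability measure, and the function $[0,1]\ni\alpha\mapsto\mathcal H_\alpha(\Lambda,\phi_0)(Q)$ is continuous at $0$. Then $$\mathcal H_\alpha(\Lambda,\phi_0)(Q)=\mathcal H^{\alpha,\alpha_0}(\Lambda,\phi_0)(Q)=\mathcal H^{\alpha,\beta,0}(\Lambda,\phi_0)(Q)=\mathcal J_\alpha(\Lambda,\phi_0)(Q)=\Phi(Q)^{1-\alpha}\Lambda(Q)^\alpha$$ for all $\alpha,\alpha_0,\beta\in[0,1]$.
   Context: Setting. Let $X$ be a set, $S:X\to X$ a bijection, $\mathcal A$ a $\sigma$-algebra on $X$, $\mathcal A_0$ the $\sigma$-algebra generated by $\bigcup_{i\ge 0}S^{-i}\mathcal A$, $\mathcal B$ the $\sigma$-algebra generated by $\bigcup_{i\in\mathbb Z}S^{-i}\mathcal A$, and $\mathcal A_m:=S^{-m}\mathcal A_0=\{S^{-m}A:A\in\mathcal A_0\}$ for integers $m\le 0$ (so $\mathcal A_0\subset\mathcal A_{-1}\subset\cdots$). Let $\phi_0$ be a finite positive measure on $\mathcal A_0$, and $\Lambda$ a finite positive measure on $\mathcal A_0$ with $\Lambda\circ S^{-1}=\Lambda$ and $\Lambda\ll\phi_0$; let $Z\ge0$ be an $\mathcal A_0$-measurable version of $d\Lambda/d\phi_0$. For $Q\subset X$ let $\mathcal C(Q)$ be the set of all sequences $(A_m)_{m\le0}$ with $A_m\in\mathcal A_m$ for all $m\le 0$ and $Q\subset\bigcup_{m\le0}A_m$.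 Define $\Phi(Q):=\inf_{(A_m)\in\mathcal C(Q)}\sum_{m\le0}\phi_0(S^mA_m)$. The symbol $\Lambda$ also denotes $\Lambda(Q):=\inf_{(A_m)\in\mathcal C(Q)}\sum_{m\le0}\Lambda(S^mA_m)$, $Q\subset X$; its restriction to $\mathcal B$ is the unique $S$-invariant measure on $\mathcal B$ extending $\Lambda$. Ergodicity is with respect to $S$. Conventions: $0\log0:=0$, $y^x:=e^{x\log y}$ and thus $0^0:=1$. For $\alpha\ge0$ and $Q\subset X$: $\mathcal H_\alpha(\Lambda,\phi_0)(Q):=\inf_{(A_m)\in\mathcal C(Q)}\sum_{m\le0}\int_{S^mA_m}Z^\alpha d\phi_0$. For $\epsilon>0$ and $\alpha,\alpha_0,\beta\in[0,1]$: $\mathcal C^{\alpha_0}_\epsilon(Q):=\{(A_m)\in\mathcal C(Q):\sum_{m\le0}\int_{S^mA_m}Z^{\alpha_0}d\phi_0<\mathcal H_{\alpha_0}(\Lambda,\phi_0)(Q)+\epsilon\}$; $\mathcal H^{\alpha,\alpha_0}(\Lambda,\phi_0)(Q):=\lim_{\epsilon\to0}\inf_{(A_m)\in\mathcal C^{\alpha_0}_\epsilon(Q)}\sum_{m\le0}\int_{S^mA_m}Z^{\alpha}d\phi_0$; $\mathcal C^{\beta,0}_\epsilon(Q):=\{(A_m)\in\mathcal C^0_\epsilon(Q):\sum_{m\le0}\int_{S^mA_m}Z^\beta d\phi_0<\mathcal H^{\beta,0}(\Lambda,\phi_0)(Q)+\epsilon\}$; $\mathcal H^{\alpha,\beta,0}(\Lambda,\phi_0)(Q):=\lim_{\epsilon\to0}\inf_{(A_m)\in\mathcal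 C^{\beta,0}_\epsilon(Q)}\sum_{m\le0}\int_{S^mA_m}Z^\alpha d\phi_0$; $\mathcal C^{0,1}_\epsilon(Q):=\{(A_m)\in\mathcal C^1_\epsilon(Q):\sum_{m\le0}\phi_0(S^mA_m)<\mathcal H^{0,1}(\Lambda,\phi_0)(Q)+\epsilon\}$ (where $\mathcal H^{0,1}(\Lambda,\phi_0)(Q)$ equals $\Phi(Q)$); $\mathcal J_\alpha(\Lambda,\phi_0)(Q):=\lim_{\epsilon\to0}\sup_{(A_m)\in\mathcal C^{0,1}_\epsilon(Q)}\sum_{m\le0}\int_{S^mA_m}Z^\alpha d\phi_0$. *)

(* Defs.v *)
From mathcomp Require Import all_boot all_order all_algebra.
From mathcomp Require Import all_classical all_reals all_analysis.

Set Implicit Arguments.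
Unset Strict Implicit.
Unset Printing Implicit Defensive.

Import Order.TTheory GRing.Theory Num.Theory.
Import numFieldNormedType.Exports.

Local Open Scope classical_set_scope.
Local Open Scope ring_scope.

Section dynamics.
Context {X : pointedType}.
Implicit Types (S : X -> X) (calA : set (set X)).

(* The image of Q under the i-th iterate of the bijection S, for i : int.
   Negative iterates are taken as preimages, so that S^-1 is not needed as
   data. *)
Definition shift S (i : int) (Q : set X) : set X :=
  match i with
  | Posz n => iter n S @` Q
  | Negz n => iter n.+1 S @^-1` Q
  end.

Definition past_gen S calA : set (set X) :=
  [set E | exists (i : nat) (A : set X), calA A /\ E = shift S (- i%:Z) A].

Definition full_gen S calA : set (set X) :=
  [set E | exists (i : int) (A : set X), calA A /\ E = shift S (- i) A].

(* X seen as a measurable space whose measurable sets are A_0. *)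
Definition space0 S calA := g_sigma_algebraType (past_gen S calA).

Definition sigmaA0 S calA : set (set X) := <<s past_gen S calA >>.

Definition sigmaB S calA : set (set X) := <<s full_gen S calA >>.

Definition sigmaA S calA (m : int) : set (set X) :=
  shift S (- m) @` sigmaA0 S calA.

(* A sequence (A_m)_{m <= 0} is encoded as A : nat -> set X, with A n standing
   for A_{-n}. *)
Definition covers S calA (Q : set X) : set (nat -> set X) :=
  [set A | (forall n : nat, sigmaA S calA (- n%:Z) (A n)) /\
           Q `<=` \bigcup_n A n].

Context {R : realType}.
Implicit Types nu : set X -> \bar R.

Local Open Scope ereal_scope.

(* The sum over m <= 0 of nu (S^m A_m). *)
Definition cover_sum S nu (A : nat -> set X) : \bar R :=
  \sum_(0 <= n <oo) nu (shift S (- n%:Z) (A n)).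

Definition dyn_outer S calA nu (Q : set X) : \bar R :=
  ereal_inf [set cover_sum S nu A | A in covers S calA Q].

(* To be applied to the restriction to B of the outer measure
   dyn_outer S calA Lambda, which is always an S-invariant measure on B.  It
   extends Lambda from A_0 exactly when it has the same total mass as Lambda. *)
Definition ergodic_probability S (B : set (set X)) nu : Prop :=
  nu setT = 1 /\
  forall E, B E -> S @^-1` E = E -> nu E = 0 \/ nu E = 1.

End dynamics.

Section densities.
Context {X : pointedType} {R : realType}.
Variables (S : X -> X) (calA : set (set X)).
Variables (phi0 : {finite_measure set (space0 S calA) -> \bar R}) (Z : X -> R).
Implicit Types (Q : set X) (a b e : R).

Local Open Scope ereal_scope.

(* powR satisfies 0 `^ 0 = 1 and 0 `^ a = 0 for a != 0. *)
Definition int_Zpow a (B : set X) : \bar R :=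
  \int[phi0]_(x in (B : set (space0 S calA))) (Z x `^ a)%:E.

Definition calH a Q : \bar R := dyn_outer S calA (int_Zpow a) Q.

Definition near_covers b e Q : set (nat -> set X) :=
  [set A | covers S calA Q A /\ cover_sum S (int_Zpow b) A < calH b Q + e%:E].

Definition calH2 a b Q : \bar R :=
  lim (ereal_inf [set cover_sum S (int_Zpow a) A | A in near_covers b e Q]
       @[e --> (0 : R)^'+]).

Definition near_covers2 b e Q : set (nat -> set X) :=
  [set A | near_covers 0 e Q A /\
           cover_sum S (int_Zpow b) A < calH2 b 0 Q + e%:E].

Definition calH3 a b Q : \bar R :=
  lim (ereal_inf [set cover_sum S (int_Zpow a) A | A in near_covers2 b e Q]
       @[e --> (0 : R)^'+]).

Definition near_covers_01 e Q : set (nat -> set X) :=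
  [set A | near_covers 1 e Q A /\
           cover_sum S (phi0 : set X -> \bar R) A < calH2 0 1 Q + e%:E].

Definition calJ a Q : \bar R :=
  lim (ereal_sup [set cover_sum S (int_Zpow a) A | A in near_covers_01 e Q]
       @[e --> (0 : R)^'+]).

End densities.

(* Main.v *)
Require Import Defs.
From HB Require Import structures.
From mathcomp Require Import all_boot all_order all_algebra.
From mathcomp Require Import all_classical all_reals all_analysis.
From mathcomp Require Import measurable_realfun ring lra.

(** Write [T] for the inverse of [S].  The outer measures built from covers by
    sets of the [A_{-n}] are finitely additive on [B], hence they can be compared
    through their total masses; since a disjoint cover never costs more than the
    total mass for the invariant measure [Lambda], some covers of [Q] are almost
    optimal for [phi0] and [Lambda] simultaneously, and by Hoelder's inequality
    such covers cost at most about [Phi(Q)^(1-a) Lambda(Q)^a] for [Z^a].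

    For the converse, let [M] be the essential supremum of [Z] for [Lambda].  As
    [Z^a phi0 >= Z^(a-1) Lambda >= M^(a-1) Lambda], every cover of [Q] costs at
    least [M^(a-1) Lambda(Q)].  If [K < M], then by recurrence and ergodicity
    almost every point of [Q] has a past iterate in [{Z > K}]; cutting a cover
    according to the first such iterate gives the upper bound
    [K^(a-1) Lambda(Q)] for [a > 0].  Continuity at [0] then forces
    [Phi(Q) <= Lambda(Q) / M], so that [M^(a-1) Lambda(Q)] is at least
    [Phi(Q)^(1-a) Lambda(Q)^a].  Finally, all the constrained quantities see the
    simultaneously optimal covers. *)

Set Implicit Arguments.
Unset Strict Implicit.
Unset Printing Implicit Defensive.

Import Order.TTheory GRing.Theory Num.Theory.
Import numFieldNormedType.Exports.

Local Open Scope classical_set_scope.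
Local Open Scope ring_scope.

(** * Real powers *)

Section real_powers.
Context (R : realType).
Implicit Types a x y z : R.

Lemma weighted_amgm a x y : 0 <= x -> 0 <= y -> 0 <= a <= 1 ->
  x `^ a * y `^ (1 - a) <= a * x + (1 - a) * y.
Proof.
move=> x0 y0 /andP[]; rewrite le_eqVlt => /predU1P[<- _|a0].
  by rewrite powRr0 subr0 powRr1// mul0r !mul1r add0r.
rewrite le_eqVlt => /predU1P[->|a1].
  by rewrite subrr powRr0 powRr1// mul0r !mul1r addr0 mulr1.
have a0' : 0 < 1 - a by rewrite subr_gt0.
have := @conjugate_powR R (x `^ a) (y `^ (1 - a)) a^-1 (1 - a)^-1.
rewrite -!powRrM !mulfV ?gt_eqF// !powRr1// !invrK (mulrC x) (mulrC y).
by apply; rewrite ?powR_ge0 ?invr_gt0// addrC subrK.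
Qed.

(* The tangent to the concave function [z |-> z ^ a] at [z = y / x]. *)
Lemma powR_le_tangent a x y z : 0 <= z -> 0 < x -> 0 < y -> 0 <= a <= 1 ->
  z `^ a <= x `^ (1 - a) * y `^ a * ((1 - a) / x + a / y * z).
Proof.
move=> z0 x0 y0 a01.
have xy0 : 0 < x / y by rewrite divr_gt0.
have := weighted_amgm (mulr_ge0 z0 (ltW xy0)) ler01 a01.
rewrite powR1 mulr1 mulr1 powRM ?(ltW xy0)//.
rewrite -(@ler_pM2l _ (x `^ (1 - a) * y `^ a / x)); last first.
  by rewrite divr_gt0// mulr_gt0// powR_gt0.
have xE : x `^ (1 - a) * x `^ a = x.
  rewrite -powRD; first by rewrite subrK powRr1 // ltW.
  by rewrite (gt_eqF x0) implybT.
have yE : (x / y) `^ a = x `^ a / y `^ a.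
  by rewrite (powRM _ (ltW x0)) ?invr_ge0 ?(ltW y0)// -(powR_inv1 (ltW y0)) -powRrM
    mulN1r powRN.
have ya0 : y `^ a != 0 by rewrite gt_eqF ?powR_gt0.
have xn0 : x != 0 by rewrite gt_eqF.
have yn0 : y != 0 by rewrite gt_eqF.
rewrite yE; set u := x `^ (1 - a) in xE *; set v := x `^ a in xE *.
set w := y `^ a in ya0 *; set r := z `^ a.
have -> : u * w / x * (r * (v / w)) = (u * v) / x * r by field; apply/andP.
rewrite xE mulfV// mul1r => /le_trans; apply.
by rewrite le_eqVlt; apply/orP; left; apply/eqP; field; apply/andP.
Qed.

Lemma powR_le_above (a K z : R) : 0 < K -> a <= 1 -> K <= z ->
  z `^ a <= K `^ (a - 1) * z.
Proof.
move=> K0 a1 Kz; have z0 : 0 < z by exact: lt_le_trans Kz.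
have -> : z `^ a = z `^ (a - 1) * z.
  by rewrite -[X in _ * X](powRr1 (ltW z0)) -powRD ?subrK// (gt_eqF z0) implybT.
rewrite ler_pM2r// -(opprB 1 a) !powRN lef_pV2 ?posrE ?powR_gt0//.
by apply: ge0_ler_powR; rewrite ?nnegrE ?subr_ge0// ltW.
Qed.

Lemma powR_ge_below (a K z : R) : 0 <= z -> a <= 1 -> z <= K ->
  K `^ (a - 1) * z <= z `^ a.
Proof.
rewrite le_eqVlt => /predU1P[<- _ _|z0 a1 zK]; first by rewrite mulr0 powR_ge0.
have -> : z `^ a = z `^ (a - 1) * z.
  by rewrite -[X in _ * X](powRr1 (ltW z0)) -powRD ?subrK// (gt_eqF z0) implybT.
have K0 : 0 < K by exact: lt_le_trans zK.
rewrite ler_pM2r// -(opprB 1 a) !powRN lef_pV2 ?posrE ?powR_gt0//.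
by apply: ge0_ler_powR; rewrite ?nnegrE ?subr_ge0// ltW.
Qed.

(** Bounds proved for positive masses [x + e] are thereby carried over to masses that may vanish. *)
Lemma powR_cvg_addr (b x : R) : 0 <= b -> 0 <= x ->
  (x + e) `^ b @[e --> 0^'+] --> x `^ b.
Proof.
rewrite le_eqVlt => /predU1P[<- _|b0].
  by rewrite powRr0; under eq_fun do rewrite powRr0; exact: cvg_cst.
rewrite le_eqVlt => /predU1P[<-|x0].
  rewrite powR0 ?gt_eqF//; under eq_fun do rewrite add0r.
  exact: powR_cvg0.
have xcvg : x + e @[e --> (0:R)^'+] --> x.
  apply: cvg_at_right_filter.
  rewrite -[X in _ --> X]addr0; apply: cvgD; [exact: cvg_cst|exact: cvg_id].
have pc : y `^ b @[y --> x] --> x `^ b.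
  have /derivable1_diffP := @ex_derive _ _ _ _ _ _ _ (is_derive1_powR b x0).
  exact: differentiable_continuous.
exact: cvg_comp xcvg pc.
Qed.

Lemma powRM_cvg_addr (p l a : R) : 0 <= p -> 0 <= l -> 0 <= a <= 1 ->
  (p + e) `^ (1 - a) * (l + e) `^ a @[e --> 0^'+] --> p `^ (1 - a) * l `^ a.
Proof.
move=> p0 l0 /andP[a0 a1].
by apply: cvgM; apply: powR_cvg_addr => //; rewrite subr_ge0.
Qed.

Lemma powRM_cvge_addr (p l a : R) : 0 <= p -> 0 <= l -> 0 <= a <= 1 ->
  ((p + e) `^ (1 - a) * (l + e) `^ a)%:E @[e --> 0^'+] -->
  (p `^ (1 - a) * l `^ a)%:E.
Proof.
move=> p0 l0 a01; apply: cvg_EFin; first exact: nearW.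
exact: powRM_cvg_addr.
Qed.

Lemma powR_cvg_exponent (K : R) : 0 < K ->
  K `^ (a - 1) @[a --> 0^'+] --> K^-1.
Proof.
move=> K0; rewrite -(powR_inv1 (ltW K0)) -[X in powR _ X](add0r (-1)).
have powE a : K `^ a = expR (a * ln K) by rewrite /powR gt_eqF.
under eq_fun do rewrite powE; rewrite powE.
apply: cvg_at_right_filter.
have ec : expR x @[x --> (0 + -1) * ln K] --> expR ((0 + -1) * ln K).
  exact: continuous_expR.
apply: cvg_comp ec; apply: cvgM; last exact: cvg_cst.
by apply: cvgB; [exact: cvg_id|exact: cvg_cst].
Qed.

(** The upper estimates near exponent 0 hold for [a > 0] only, so continuity on the interval is used
    as a limit from the right. *)
Lemma near_at_right_within01 (P : R -> Prop) :
  (\forall a \near within `[0, 1] (nbhs (0 : R)), P a) -> \forall a \near (0:R)^'+, P a.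
Proof.
rewrite !near_withinE => H; near=> a; rewrite /= => a0.
have Pa : `[0, 1]%classic a -> P a by near: a.
apply: Pa; rewrite /= in_itv/= (ltW a0)/=.
apply: ltW; near: a; apply: lt_nbhsl; exact: ltr01.
Unshelve. all: by end_near. Qed.
End real_powers.

(** * Outer measures defined by covers *)

Section iter_cancel.
Context (X : Type) (f g : X -> X).
Hypothesis fK : cancel f g.

Lemma iter_can n : cancel (iter n f) (iter n g).
Proof. by elim: n => // n IH x; rewrite (iterSr _ g) /= fK IH. Qed.

Lemma iter_can_le k n x : (k <= n)%N -> iter k g (iter n f x) = iter (n - k) f x.
Proof. by move=> kn; rewrite -{1}(subnKC kn) iterD iter_can. Qed.

Lemma iter_can_ge k n x : (k <= n)%N -> iter n g (iter k f x) = iter (n - k) g x.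
Proof. by move=> kn; rewrite -{1}(subnK kn) iterD iter_can. Qed.
End iter_cancel.

Section cover_outer_measure.
Context d (X : measurableType d) (R : realType) (S T : X -> X).
Hypotheses (SK : cancel S T) (TK : cancel T S).
Hypothesis mS : forall A, measurable A -> measurable (S @^-1` A).
Local Open Scope ereal_scope.

(* The cover [(A_m)_{m <= 0}] of the informal statement is encoded by the sets
   [B n = S^(-n) A_{-n}] of [A_0], so that [A_{-n}] is the preimage of [B n]
   under the [n]-th iterate of [T]. *)
Definition tcovers (Q : set X) : set (nat -> set X) :=
  [set B | (forall n, measurable (B n)) /\
           forall x, Q x -> exists n, B n (iter n T x)].

Definition touter (nu : set X -> \bar R) (Q : set X) : \bar R :=
  ereal_inf [set \sum_(0 <= n <oo) nu (B n) | B in tcovers Q].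

Lemma measurable_iterS n A : measurable A -> measurable (iter n S @^-1` A).
Proof.
elim: n A => // n IH A mA.
by rewrite (_ : _ @^-1` A = iter n S @^-1` (S @^-1` A))//; apply/IH/mS.
Qed.

Section measure.
Variable nu : {measure set X -> \bar R}.

Lemma touter_ge0 Q : 0 <= touter nu Q.
Proof. by apply: le_ereal_inf_tmp => _ [B _ <-]; exact: nneseries_ge0. Qed.

Lemma touter_le_cover Q B : tcovers Q B ->
  touter nu Q <= \sum_(0 <= n <oo) nu (B n).
Proof. by move=> QB; apply: ereal_inf_lbound; exists B. Qed.

Lemma le_touter : {homo touter nu : A B / A `<=` B >-> A <= B}.
Proof.
move=> A B AB; apply: ereal_inf_le_tmp => _ [C [mC BC] <-]; exists C => //.
by split=> // x /AB /BC.
Qed.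

Lemma touter_measurable B : measurable B -> touter nu B <= nu B.
Proof.
move=> mB; pose C n := if n is 0%N then B else set0.
apply: (le_trans (@touter_le_cover B C _)).
  split; first by case=> [|n]; rewrite /C.
  by move=> x Bx; exists 0%N.
rewrite nneseries_recl//= [X in _ + X](_ : _ = 0) ?adde0//.
by apply: eseries0 => -[|n] //= _ _; rewrite measure0.
Qed.

Lemma touter0 : touter nu set0 = 0.
Proof.
apply/eqP; rewrite eq_le touter_ge0 andbT.
by rewrite -[leRHS](measure0 nu); exact: touter_measurable.
Qed.

(** Delaying a cover by one index, with the empty set at index 0, costs nothing. This gives only an
    inequality, since a cover of the preimage may use index 0. *)
Lemma touter_shift Q : touter nu (T @^-1` Q) <= touter nu Q.
Proof.
apply: le_ereal_inf_tmp => _ [B [mB QB] <-].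
pose C n := if n is m.+1 then B m else set0.
apply: (le_trans (@touter_le_cover _ C _)).
  split; first by case=> [|n]; rewrite /C.
  by move=> x /= /QB[n Bn]; exists n.+1; rewrite iterSr.
rewrite [leLHS]nneseries_recl//= measure0 add0e.
rewrite -(@nneseries_addn _ _ 1) => [|[|n]]//=.
by apply: lee_nneseries => // n _; rewrite addn1.
Qed.

Lemma touter_iter n Q : touter nu (iter n T @^-1` Q) <= touter nu Q.
Proof.
elim: n Q => // n IH Q.
rewrite (_ : _ @^-1` Q = iter n T @^-1` (T @^-1` Q))//.
exact: le_trans (IH _) (touter_shift _).
Qed.

Lemma touter_sigma_subadditive : sigma_subadditive (touter nu).
Proof.
move=> F.
have [[i Fi]|/forallNP Foo] := pselect (exists i, touter nu (F i) = +oo).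
  by rewrite (nneseries_pinfty (k := i))//= ?leey// => n _; exact: touter_ge0.
have Ffin i : touter nu (F i) \is a fin_num.
  by rewrite ge0_fin_numE ?touter_ge0// lt_neqAle leey andbT; apply/eqP/Foo.
apply/lee_addgt0Pr => e e0.
have /choice[B HB] i : exists B, tcovers (F i) B /\
    \sum_(0 <= n <oo) nu (B n) <= touter nu (F i) + (e / (2 ^ i.+1)%:R)%:E.
  have ei0 : (0 < e / (2 ^ i.+1)%:R)%R.
    by rewrite divr_gt0// ltr0n expn_gt0.
  have [_ [B FB <-] /ltW] := lb_ereal_inf_adherent ei0 (Ffin i).
  by exists B.
(* The covers are merged index by index: a countable union of sets of [A_0] is again one, so each
   index still carries a single set. *)
apply: (@le_trans _ _ (\sum_(0 <= n <oo) nu (\bigcup_i B i n))).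
  apply: touter_le_cover; split.
    by move=> n; apply: bigcupT_measurable => i; have [[]] := HB i.
  move=> x [i _ Fix]; have [[_ /(_ _ Fix)[n Bn]] _] := HB i.
  by exists n, i.
apply: (@le_trans _ _ (\sum_(0 <= n <oo) \sum_(0 <= i <oo) nu (B i n))).
  apply: lee_nneseries => // n _; apply: measure_sigma_subadditive => //.
    by move=> i; have [[]] := HB i.
  by apply: bigcupT_measurable => i; have [[]] := HB i.
rewrite nneseries_interchange//.
apply: le_trans (epsilon_trick xpredT _ (ltW e0)).
  apply: lee_nneseries => [i _ _|i _]; first exact: nneseries_ge0.
  by have [_] := HB i.
by move=> i; exact: touter_ge0.
Qed.

HB.instance Definition _ := isOuterMeasure.Build R X (touter nu)
  touter0 touter_ge0 le_touter touter_sigma_subadditive.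

Lemma touter_le_mass Q : touter nu Q <= nu setT.
Proof. exact: le_trans (le_touter (@subsetT _ _)) (touter_measurable _). Qed.

(** Up to renumbering, this uses the covers of [Q] whose sets of index below [N] are empty. *)
Let tlevel Q N := touter nu (iter N S @^-1` Q).

(* Sets of [A_{-k}] split covers by [A_{-n}], [n >= k], only; passing to the
   limit over the covers starting at [n = N] makes them Caratheodory measurable. *)
Definition tsup Q := limn (tlevel Q).

Let tlevel_nd Q : {homo tlevel Q : n m / (n <= m)%N >-> n <= m}.
Proof.
apply/nondecreasing_seqP => n; rewrite /tlevel.
apply: le_trans (touter_shift _); rewrite le_eqVlt; apply/orP; left; apply/eqP.
by congr touter; apply/seteqP; split => x /=; rewrite -iterS iterSr TK.
Qed.

Let tlevel_cvg Q : cvgn (tlevel Q).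
Proof. exact: ereal_nondecreasing_is_cvgn. Qed.

Let tlevel_le Q n : tlevel Q n <= tsup Q.
Proof.
rewrite /tsup (cvg_lim _ (ereal_nondecreasing_cvgn (@tlevel_nd Q)))//.
by apply: ereal_sup_ubound; exists n.
Qed.

Lemma touter_le_tsup Q : touter nu Q <= tsup Q.
Proof. exact: (@tlevel_le Q 0%N). Qed.

Lemma tsupT : tsup setT = touter nu setT.
Proof.
rewrite /tsup (_ : tlevel setT = cst (touter nu setT)) ?lim_cst//.
Qed.

Let tsup0 : tsup set0 = 0.
Proof.
rewrite /tsup (_ : tlevel set0 = cst 0) ?lim_cst//.
by apply/funext => n; rewrite /tlevel preimage_set0 touter0.
Qed.

Let tsup_ge0 Q : 0 <= tsup Q.
Proof. exact: le_trans (touter_ge0 _) (touter_le_tsup _). Qed.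

Let le_tsup : {homo tsup : A B / A `<=` B >-> A <= B}.
Proof.
move=> A B AB; apply: lee_lim => //; apply: nearW => n.
by apply: le_touter => x; exact: AB.
Qed.

Let tsup_sigma_subadditive : sigma_subadditive tsup.
Proof.
move=> F; apply: lime_le => //; apply: nearW => n.
rewrite /tlevel preimage_bigcup.
apply: (le_trans (touter_sigma_subadditive _)).
apply: lee_nneseries => [i _ _|i _]; [exact: touter_ge0|exact: tlevel_le].
Qed.

HB.instance Definition _ := isOuterMeasure.Build R X tsup
  tsup0 tsup_ge0 le_tsup tsup_sigma_subadditive.

(** Cutting [A_{-n}] by [A] amounts to cutting [B n] by the preimage of [A] under the [n]-th iterate
    of [S], which is still in [A_0]. *)
Lemma touter_split A Q : measurable A ->
  touter nu (Q `&` A) + touter nu (Q `&` ~` A) <= touter nu Q.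
Proof.
move=> mA; apply: le_ereal_inf_tmp => _ [B [mB QB] <-].
pose A' n := iter n S @^-1` A.
have mA' n : measurable (A' n) by exact: measurable_iterS.
apply: (@le_trans _ _ (\sum_(0 <= n <oo) nu (B n `&` A' n) +
                       \sum_(0 <= n <oo) nu (B n `&` ~` A' n))).
  apply: leeD; apply: touter_le_cover; split.
  - by move=> n; apply: measurableI.
  - by move=> x [/QB[n Bn] Ax]; exists n; split => //; rewrite /A' /= (iter_can TK).
  - by move=> n; apply: measurableI => //; exact: measurableC.
  - by move=> x [/QB[n Bn] Ax]; exists n; split => //; rewrite /A' /= (iter_can TK).
rewrite -nneseriesD//; apply: lee_nneseries => [n _ _|n _]; first exact: adde_ge0.
rewrite -measureU//.
- by rewrite -setIUr setUCr setIT.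
- exact: measurableI.
- by apply: measurableI => //; exact: measurableC.
- by rewrite setIACA setICr setI0.
Qed.

(** From level [k] on, the pulled-back set lies in [A_0] and [touter_split] applies; the limit
    ignores the earlier levels. *)
Lemma tsup_caratheodory k A : measurable A -> tsup.-caratheodory (iter k T @^-1` A).
Proof.
move=> mA; apply: le_caratheodory_measurable => Q.
have Qdef : tsup (Q `&` iter k T @^-1` A) +? tsup (Q `&` ~` (iter k T @^-1` A)).
  by apply: ge0_adde_def; rewrite inE; exact: tsup_ge0.
rewrite -limeD//; apply: lee_lim => //; first exact: is_cvgeD.
exists k => // n /= kn.
have E : (iter n S @^-1` (iter k T @^-1` A)) = iter (n - k) S @^-1` A.
  by apply/seteqP; split=> x /=; rewrite (iter_can_le SK).
rewrite /tlevel 2!preimage_setI -preimage_setC E.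
exact/touter_split/measurable_iterS.
Qed.

(** The Caratheodory sets of [tsup] form a sigma-algebra containing [G]; moreover [touter] is at
    most [tsup], with equality on the whole space. *)
Lemma touter_setC (G : set (set X)) Q :
  (forall E, G E -> exists k A, measurable A /\ E = iter k T @^-1` A) ->
  <<s G >> Q -> touter nu Q + touter nu (~` Q) <= touter nu setT.
Proof.
move=> HG GQ.
have caraQ : tsup.-caratheodory Q.
  move: Q GQ; apply: smallest_sub.
    split; first exact: caratheodory_measurable_set0.
      by move=> A; rewrite setTD; exact: caratheodory_measurable_setC.
    by move=> F; exact: caratheodory_measurable_bigcup.
  by move=> E /HG[k [A [mA ->]]]; exact: tsup_caratheodory.
have := caraQ setT; rewrite !setTI tsupT => ->.
by apply: leeD; exact: touter_le_tsup.
Qed.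

End measure.

(** Each point is kept only in the covering set of least index. The last clause expresses the
    disjointness of the sets [A_{-n}] through the sets [C n] of [A_0]. *)
Lemma tcovers_disjoint B Q : tcovers Q B -> exists C, [/\ tcovers Q C,
  forall n, C n `<=` B n &
  forall k n y, (k < n)%N -> C n y -> ~ C k (iter (n - k) S y)].
Proof.
move=> [mB QB].
exists (fun n => B n `\` \bigcup_(k in `I_n) (iter (n - k) S @^-1` B k)); split.
- split=> [n|x Qx].
    apply: measurableD => //; apply: bigcup_measurable => k _.
    exact: measurable_iterS.
  have exB : exists n, `[< B n (iter n T x) >].
    by have [n Bn] := QB _ Qx; exists n; exact/asboolP.
  case: (ex_minnP exB) => n /asboolP Bn nmin; exists n; split => //.
  move=> [k /= kn]; rewrite (iter_can_le TK) ?leq_subr// => Bk.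
  have /nmin : `[< B k (iter k T x) >].
    by apply/asboolP; move: Bk; rewrite subKn// ltnW.
  by rewrite leqNgt kn.
- by move=> n; exact: subDsetl.
- by move=> k n y kn [_ nB] [Bk _]; apply: nB; exists k.
Qed.

(** * Recurrence for an invariant measure *)

Section invariant_measure.
Variable L : {measure set X -> \bar R}.
Hypothesis LS : forall A, measurable A -> L (S @^-1` A) = L A.

Lemma measure_iterS n A : measurable A -> L (iter n S @^-1` A) = L A.
Proof.
elim: n A => // n IH A mA.
by rewrite (_ : _ @^-1` A = iter n S @^-1` (S @^-1` A))// IH ?LS//; exact: mS.
Qed.

Lemma disjoint_pieces_le B C : measurable B -> (forall n, measurable (C n)) ->
  (forall n, C n `<=` iter n S @^-1` B) ->
  (forall k n y, (k < n)%N -> C n y -> ~ C k (iter (n - k) S y)) ->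
  \sum_(0 <= n <oo) L (C n) <= L B.
Proof.
move=> mB mC CB Cdisj; apply: lime_le; first exact: is_cvg_nneseries.
apply: nearW => N; rewrite -(@measure_iterS N B)// big_mkord.
(* Pulled back to the common time [N], the first [N] pieces become disjoint subsets of one preimage
   of [B], with unchanged mass. *)
pose F (i : 'I_N) := iter (N - i) S @^-1` C i.
have mF i : measurable (F i) by exact: measurable_iterS.
rewrite (eq_bigr (fun i => L (F i))); last first.
  by move=> i _; rewrite measure_iterS.
rewrite -measure_bigsetU_ord//.
  apply: le_measure; rewrite ?inE//; first exact: bigsetU_measurable.
    exact: measurable_iterS.
  elim/big_ind: _ => //.
    by move=> U V UB VB; rewrite subUset.
  move=> i _ x /CB /=.
  by rewrite -iterD subnKC// ltnW.
have disj (i j : 'I_N) x : (i < j)%N -> F i x -> F j x -> False.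
  move=> ij Fi /Cdisj; apply; first exact: ij.
  by rewrite -iterD addnC addnBA ?(ltnW ij)// subnK// ltnW.
apply/trivIsetP => i j _ _ ij; apply/seteqP; split => // x [Fi Fj].
have [|ji|/val_inj] := ltngtP i j; first by move/disj; apply; eassumption.
  by apply: (disj _ _ _ ji); eassumption.
by move/eqP; rewrite (negbTE ij).
Qed.

Hypothesis Lfin : L setT < +oo.

(* The sets [V k] of the proof are disjoint subsets of [A_0] of bounded total
   mass, and each of them covers the set of points without past return. *)
Lemma touter_wandering0 E : measurable E ->
  touter L (E `\` \bigcup_n (iter n.+1 T @^-1` E)) = 0.
Proof.
move=> mE; set W := E `\` _.
pose V k := iter k S @^-1` E `\` \bigcup_(j in `I_k) (iter j S @^-1` E).
have mV k : measurable (V k).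
  apply: measurableD; first exact: measurable_iterS.
  by apply: bigcup_measurable => j _; exact: measurable_iterS.
have WV k : touter L W <= L (V k).
  apply: le_trans (touter_measurable L (mV k)).
  apply: le_trans (touter_iter L k _); apply: le_touter => x [Ex nE].
  split=> /=; first by rewrite (iter_can TK).
  move=> [j /= jk]; rewrite (iter_can_le TK) ?(ltnW jk)// => Ej.
  by apply: nE; exists (k - j).-1 => //=; rewrite -iterS prednK ?subn_gt0.
have Vdisj : trivIset setT V.
  suff disj i j x : (i < j)%N -> V i x -> V j x -> False.
    apply/trivIsetP => i j _ _ ij; apply/seteqP; split => // x [Vi Vj].
    have [ij'|ji|eij] := ltngtP i j; first exact: disj ij' Vi Vj.
      exact: disj ji Vj Vi.
    by rewrite eij eqxx in ij.
  by move=> ij [Ei _] [_]; apply; exists i.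
have nW n : (n%:R)%:E * touter L W <= L setT.
  apply: (@le_trans _ _ (L (\big[setU/set0]_(k < n) V k))).
    rewrite measure_bigsetU//; elim: n => [|n IH]; first by rewrite mul0e big_ord0.
    rewrite big_ord_recr/= -natr1 EFinD ge0_muleDl ?lee_fin// mul1e.
    exact: leeD.
  by apply: le_measure; rewrite ?inE//; exact: bigsetU_measurable.
have Wfin : touter L W \is a fin_num.
  rewrite ge0_fin_numE ?touter_ge0//; apply: le_lt_trans Lfin.
  by apply: le_trans (nW 1%N); rewrite mul1e.
have := touter_ge0 L W; rewrite le_eqVlt => /predU1P[//|W0].
have LTfin : L setT \is a fin_num by rewrite ge0_fin_numE.
move: W0 nW; rewrite -(fineK Wfin) -(fineK LTfin) lte_fin => W0 nW.
exfalso; set w := fine _ in W0 nW; set l := fine _ in nW.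
have := nW (Num.truncn (l / w)).+1; apply/negP; rewrite -ltNge -EFinM lte_fin.
by rewrite -ltr_pdivrMr// truncnS_gt.
Qed.

(** Asking for infinitely many past visits, and not just one, makes the set exactly [S]-invariant,
    so that ergodicity applies to it. *)
Definition recurrent (E : set X) : set X :=
  [set x | forall k, exists n, (k <= n)%N /\ E (iter n T x)].

Lemma recurrentS E : S @^-1` recurrent E = recurrent E.
Proof.
apply/seteqP; split => x rx k.
  have [n [kn En]] := rx k.+1; exists n.-1.
  by case: n En kn => // n; rewrite iterSr SK.
have [n [kn En]] := rx k; exists n.+1; split; first exact: leqW.
by rewrite iterSr SK.
Qed.

(** A non-recurrent point of [E] has a last past visit to [E], which lies in the null set of
    [touter_wandering0]; the countably many preimages of that set are null too. *)
Lemma touter_recurrent E : measurable E -> touter L E <= touter L (recurrent E).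
Proof.
move=> mE; set W := E `\` \bigcup_n (iter n.+1 T @^-1` E).
pose F n := if n is m.+1 then iter m T @^-1` W else recurrent E.
apply: (@le_trans _ _ (touter L (\bigcup_n F n))).
  apply: le_touter => x Ex.
  have [rx|/existsNP[k /forallNP nk]] := pselect (recurrent E x).
    by exists 0%N.
  have exE : exists n, `[< E (iter n T x) >] by exists 0%N; exact/asboolP.
  have ubE n : `[< E (iter n T x) >] -> (n <= k)%N.
    move=> /asboolP En; rewrite leqNgt; apply/negP => kn.
    by apply: (nk n); split => //; exact: ltnW.
  case: (ex_maxnP exE ubE) => n /asboolP En nmax.
  exists n.+1 => //; split => // -[m _] /=.
  rewrite -iterS -iterD => /asboolP/nmax.
  by rewrite addSn ltnNge leq_addl.
apply: (le_trans (touter_sigma_subadditive L F)).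
rewrite nneseries_recl//; last by move=> k _; exact: touter_ge0.
rewrite (_ : \sum_(1 <= k <oo) _ = 0) ?adde0//.
apply: eseries0 => -[|n] // _ _; apply/eqP; rewrite eq_le touter_ge0 andbT.
by rewrite -(touter_wandering0 mE); exact: touter_iter.
Qed.

(* The sets [D m] of the proof collect the points whose first past iterate in
   [E] has time [m]. *)
Lemma touter_setI_recurrent (nu : {measure set X -> \bar R}) (c : R) E Q :
  measurable E -> (0 < c)%R ->
  (forall D, measurable D -> D `<=` E -> nu D <= c%:E * L D) ->
  touter nu (Q `&` recurrent E) <= c%:E * touter L Q.
Proof.
move=> mE c0 nuL.
have base B : measurable B -> touter nu (B `&` recurrent E) <= c%:E * L B.
  move=> mB.
  pose D m := E `&` iter m S @^-1` B `\`
    \bigcup_(j in `I_m) (iter (m - j) S @^-1` E).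
  have mD m : measurable (D m).
    apply: measurableD; first by apply: measurableI => //; exact: measurable_iterS.
    by apply: bigcup_measurable => j _; exact: measurable_iterS.
  apply: (@le_trans _ _ (\sum_(0 <= m <oo) nu (D m))).
    apply: touter_le_cover; split => // x [Bx rx].
    have exE : exists n, `[< E (iter n T x) >].
      by have [n [_ En]] := rx 0%N; exists n; exact/asboolP.
    case: (ex_minnP exE) => n /asboolP En nmin; exists n; split.
      by split => //=; rewrite (iter_can TK).
    move=> [j /= jn]; rewrite (iter_can_le TK) ?leq_subr// subKn ?(ltnW jn)//.
    by move=> /asboolP/nmin; rewrite leqNgt jn.
  apply: (@le_trans _ _ (\sum_(0 <= m <oo) c%:E * L (D m))).
    by apply: lee_nneseries => // m _; apply: nuL => // x [[]].
  rewrite nneseriesZl// lee_pmul2l//; apply: disjoint_pieces_le => //.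
    by move=> m x [[]].
  by move=> k n y kn [_ nE] [[Ek _] _]; apply: nE; exists k.
(* For arbitrary [Q], [base] is applied to each set of a cover, and the invariance of [recurrent E]
   allows moving it along [T]. *)
rewrite -lee_pdivrMl//; apply: le_ereal_inf_tmp => _ [B [mB QB] <-].
rewrite lee_pdivrMl// -nneseriesZl//.
apply: (@le_trans _ _ (\sum_(0 <= n <oo)
    touter nu (iter n T @^-1` (B n `&` recurrent E)))).
  apply: le_trans (touter_sigma_subadditive nu _).
  apply: le_touter => x [/QB[n Bn] rx]; exists n => //; split => //=.
  elim: n {Bn} => // n IH; rewrite /= -[X in X _]recurrentS /=.
  by rewrite TK.
apply: lee_nneseries => [n _ _|n _]; first exact: touter_ge0.
exact: le_trans (touter_iter _ _ _) (base _ (mB n)).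
Qed.
End invariant_measure.
End cover_outer_measure.

(** * Covers almost optimal for two measures at once *)

Section simultaneous_covers.
Context d (X : measurableType d) (R : realType) (S T : X -> X).
Hypotheses (SK : cancel S T) (TK : cancel T S).
Hypothesis mS : forall A, measurable A -> measurable (S @^-1` A).
Variables phi L : {finite_measure set X -> \bar R}.
Hypothesis LS : forall A, measurable A -> L (S @^-1` A) = L A.
Hypothesis L_total : touter T L setT = L setT.
Local Open Scope ereal_scope.

Lemma touter_fin_num (nu : {finite_measure set X -> \bar R}) Q :
  touter T nu Q \is a fin_num.
Proof.
rewrite ge0_fin_numE ?touter_ge0//; apply: le_lt_trans (touter_le_mass _ _ _) _.
by rewrite ltey_eq fin_num_measure.
Qed.

(** The two costs are minimised together by minimising their sum. *)
Let m : {measure set X -> \bar R} := measure_add phi L.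

Let mE A : m A = phi A + L A.
Proof. exact: measure_addE. Qed.

Let msum (B : nat -> set X) : \sum_(0 <= n <oo) m (B n) =
  \sum_(0 <= n <oo) phi (B n) + \sum_(0 <= n <oo) L (B n).
Proof.
by rewrite -nneseriesD//; apply: eq_eseriesr => n _; rewrite mE.
Qed.

Let touter_add_ge Q : touter T phi Q + touter T L Q <= touter T m Q.
Proof.
apply: le_ereal_inf_tmp => _ [B QB <-]; rewrite msum.
by apply: leeD; exact: touter_le_cover.
Qed.

(** A nearly optimal cover for [phi], made disjoint, costs no more for [phi] and at most [L setT]
    for [L]; by [L_total] this is the least cost possible for [L]. *)
Let touter_addT : touter T m setT <= touter T phi setT + touter T L setT.
Proof.
apply/lee_addgt0Pr => e e0.
have [_ [B TB <-] Be] := lb_ereal_inf_adherent e0 (touter_fin_num phi setT).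
have [C [TC CB Cdisj]] := tcovers_disjoint TK mS TB.
have mB := proj1 TB; have mC := proj1 TC.
apply: (le_trans (touter_le_cover _ TC)); rewrite msum addeAC.
apply: leeD.
  apply: le_trans (ltW Be); apply: lee_nneseries => // n _.
  by apply: le_measure; rewrite ?inE.
by rewrite L_total; apply: (disjoint_pieces_le mS LS).
Qed.

(* Superadditivity holds for all sets; with additivity on complements, it is
   enough to compare the masses of the whole space. *)
Lemma touter_add_le (G : set (set X)) Q :
  (forall E, G E -> exists k A, measurable A /\ E = iter k T @^-1` A) ->
  <<s G >> Q -> touter T m Q <= touter T phi Q + touter T L Q.
Proof.
move=> HG GQ.
have mfin A : touter T m A \is a fin_num.
  rewrite ge0_fin_numE ?touter_ge0//; apply: le_lt_trans (touter_le_mass _ _ _) _.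
  by rewrite mE ltey_eq fin_numD !fin_num_measure.
have IC (nu : {measure set X -> \bar R}) :
    touter T nu setT <= touter T nu Q + touter T nu (~` Q).
  by rewrite -(setUv Q); exact: outer_measureU2.
have := touter_setC SK TK mS m HG GQ.
have := touter_add_ge (~` Q).
have := touter_addT; have := IC phi; have := IC L.
move: (mfin Q) (mfin (~` Q)) (mfin setT) (touter_fin_num phi Q)
  (touter_fin_num phi (~` Q)) (touter_fin_num phi setT) (touter_fin_num L Q)
  (touter_fin_num L (~` Q)) (touter_fin_num L setT).
do 3 (case: (touter T m _) => // ? _).
do 3 (case: (touter T phi _) => // ? _).
do 3 (case: (touter T L _) => // ? _).
(* The masses for [m] of [Q] and its complement add up to at most those of [phi] and [L] on both
   sets; the superadditive bound on the complement is then subtracted. *)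
rewrite -!EFinD !lee_fin; lra.
Qed.

(** For a cover almost optimal for [m], the excesses over the two separate infima are nonnegative
    and add up to less than [e]. *)
Lemma simultaneous_cover (G : set (set X)) Q (e : R) :
  (forall E, G E -> exists k A, measurable A /\ E = iter k T @^-1` A) ->
  <<s G >> Q -> (0 < e)%R -> exists B, [/\ tcovers T Q B,
    \sum_(0 <= n <oo) phi (B n) < touter T phi Q + e%:E &
    \sum_(0 <= n <oo) L (B n) < touter T L Q + e%:E].
Proof.
move=> HG GQ e0; have mQ := touter_add_le HG GQ.
have mfin : touter T m Q \is a fin_num.
  rewrite ge0_fin_numE ?touter_ge0//; apply: le_lt_trans mQ _.
  by rewrite ltey_eq fin_numD !touter_fin_num.
have [_ [B QB <-] Be] := lb_ereal_inf_adherent e0 mfin.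
exists B; have := touter_le_cover phi QB; have := touter_le_cover L QB.
have := lt_le_trans Be (leeD2r _ mQ); rewrite msum.
set p := \sum_(_ <= _ <oo) phi _; set l := \sum_(_ <= _ <oo) L _.
have p0 : 0 <= p by exact: nneseries_ge0.
have l0 : 0 <= l by exact: nneseries_ge0.
have -> : touter T phi Q = (fine (touter T phi Q))%:E by rewrite fineK ?touter_fin_num.
have -> : touter T L Q = (fine (touter T L Q))%:E by rewrite fineK ?touter_fin_num.
case: p p0 => [p| |]// p0; case: l l0 => [l| |]// l0.
by rewrite -!EFinD !lte_fin !lee_fin => ? ? ?; split => //; lra.
Qed.
End simultaneous_covers.

(** * Costs with density [Z ^ a] *)

Section densities.
Context d (X : measurableType d) (R : realType).
Variables (phi L : {finite_measure set X -> \bar R}) (Z : X -> R).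
Hypothesis Z0 : forall x, 0 <= Z x.
Hypothesis mZ : measurable_fun setT Z.
Hypothesis LZ : forall B, measurable B -> L B = (\int[phi]_(x in B) (Z x)%:E)%E.
Local Open Scope ereal_scope.

Definition zpow (a : R) (B : set X) := \int[phi]_(x in B) (Z x `^ a)%:E.

Let mZpow a B : measurable_fun B (EFin \o (fun x => Z x `^ a)%R).
Proof.
apply/measurable_EFinP/measurable_funTS.
exact: measurableT_comp (measurable_powR a) mZ.
Qed.

Let mZE B : measurable_fun B (EFin \o Z).
Proof. exact/measurable_EFinP/measurable_funTS. Qed.

Let zpow_measure0 a : zpow a set0 = 0.
Proof. exact: integral_set0. Qed.

Let zpow_measure_ge0 a B : 0 <= zpow a B.
Proof. by apply: integral_ge0 => x _; rewrite lee_fin powR_ge0. Qed.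

Let zpow_sigma_additive a : semi_sigma_additive (zpow a).
Proof.
move=> F mF tF mUF; rewrite /zpow ge0_integral_bigcup//; last first.
  by move=> x _; rewrite lee_fin powR_ge0.
  exact: mZpow.
apply: is_cvg_nneseries => n _ _; exact: zpow_measure_ge0.
Qed.

HB.instance Definition _ a := isMeasure.Build _ _ _ (zpow a)
  (zpow_measure0 a) (zpow_measure_ge0 a) (@zpow_sigma_additive a).

Lemma zpow0 B : measurable B -> zpow 0 B = phi B.
Proof.
move=> mB; rewrite /zpow; under eq_integral do rewrite powRr0.
by rewrite integral_cst// mul1e.
Qed.

Lemma zpow1 B : measurable B -> zpow 1 B = L B.
Proof.
by move=> mB; rewrite LZ// /zpow; under eq_integral do rewrite powRr1//.
Qed.

(** The integrated tangent inequality is a form of Hoelder's inequality linear in [phi] and [L],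
    hence can be summed over a cover. *)
Lemma zpow_le_tangent a x y B : measurable B -> (0 < x)%R -> (0 < y)%R ->
  (0 <= a <= 1)%R -> zpow a B <= (x `^ (1 - a) * y `^ a)%:E *
    (((1 - a) / x)%:E * phi B + (a / y)%:E * L B).
Proof.
move=> mB x0 y0 a01; have /andP[a0 a1] := a01.
set u := (x `^ (1 - a) * y `^ a)%R; set v := ((1 - a) / x)%R; set w := (a / y)%R.
have u0 : (0 <= u)%R by rewrite mulr_ge0// powR_ge0.
have v0 : (0 <= v)%R by rewrite divr_ge0 ?subr_ge0// ltW.
have w0 : (0 <= w)%R by rewrite divr_ge0// ltW.
have -> : u%:E * (v%:E * phi B + w%:E * L B) =
    \int[phi]_(t in B) (u%:E * (v%:E + w%:E * (Z t)%:E)).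
  rewrite ge0_integralZl_EFin//; last 2 first.
  - by move=> t _; rewrite -EFinM -EFinD lee_fin addr_ge0// mulr_ge0.
  - by apply: emeasurable_funD => //; apply: measurable_funeM.
  rewrite ge0_integralD//; last 2 first.
  - by move=> t _; rewrite -EFinM lee_fin mulr_ge0.
  - by apply: measurable_funeM.
  rewrite integral_cst// ge0_integralZl_EFin//; first by rewrite -LZ.
  by move=> t _; rewrite lee_fin.
apply: ge0_le_integral => //.
- by move=> t _; rewrite lee_fin powR_ge0.
- exact: mZpow.
- by apply: measurable_funeM; apply: emeasurable_funD => //; apply: measurable_funeM.
- by move=> t _; rewrite -EFinM lee_fin; exact: powR_le_tangent.
Qed.

Lemma zpow_le_above a K B : measurable B -> (0 < K)%R -> (0 <= a <= 1)%R ->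
  B `<=` [set x | K < Z x]%R -> zpow a B <= (K `^ (a - 1))%:E * L B.
Proof.
move=> mB K0 /andP[a0 a1] BK; rewrite LZ// -ge0_integralZl_EFin ?powR_ge0//; last first.
  by move=> x _; rewrite lee_fin.
apply: ge0_le_integral => //.
- by move=> t _; rewrite lee_fin powR_ge0.
- exact: mZpow.
- exact: measurable_funeM.
- move=> t /BK Kt; rewrite -EFinM lee_fin.
  by apply: powR_le_above => //; exact: ltW.
Qed.

Lemma measurable_superlevel K : measurable [set x | K < Z x]%R.
Proof.
rewrite (_ : [set x | _] = Z @^-1` `]K, +oo[%classic).
  by rewrite -[X in measurable X]setTI; exact: mZ.
by apply/seteqP; split => x /=; rewrite in_itv/= andbT.
Qed.

(** The part of [B] above level [K] is [L]-null and may be discarded; on the rest, [Z ^ a] dominates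
    [K ^ (a - 1) * Z]. *)
Lemma zpow_ge_below a K B : measurable B -> (0 < K)%R -> (0 <= a <= 1)%R ->
  L [set x | K < Z x]%R = 0 -> (K `^ (a - 1))%:E * L B <= zpow a B.
Proof.
move=> mB K0 a01 LK.
set E := [set x | K < Z x]%R in LK.
have mE : measurable E by exact: measurable_superlevel.
have mBE : measurable (B `\` E) by exact: measurableD.
have -> : L B = L (B `\` E).
  rewrite (measureDI L mB mE) [X in _ + X](_ : _ = 0) ?adde0//.
  by apply: subset_measure0 LK => //; exact: measurableI.
apply: (@le_trans _ _ (zpow a (B `\` E))); last first.
  apply: ge0_subset_integral => //; first exact: mZpow.
  by move=> x _; rewrite lee_fin powR_ge0.
rewrite LZ// -ge0_integralZl_EFin ?powR_ge0//; last first.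
  by move=> x _; rewrite lee_fin.
apply: ge0_le_integral => //.
- by move=> t _; rewrite -EFinM lee_fin mulr_ge0 ?powR_ge0.
- exact: measurable_funeM.
- exact: mZpow.
- move=> t [_ /negP]; rewrite -leNgt -EFinM lee_fin => ZK.
  by apply: powR_ge_below => //; case/andP: a01.
Qed.

(** The tangent is taken at the ratio [y / x] of the two bounds, so that its weighted terms sum to
    at most [(1 - a) + a = 1]. *)
Lemma cover_zpow_le a x y (B : nat -> set X) : (forall n, measurable (B n)) ->
  (0 < x)%R -> (0 < y)%R -> (0 <= a <= 1)%R ->
  \sum_(0 <= n <oo) phi (B n) <= x%:E -> \sum_(0 <= n <oo) L (B n) <= y%:E ->
  \sum_(0 <= n <oo) zpow a (B n) <= (x `^ (1 - a) * y `^ a)%:E.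
Proof.
move=> mB x0 y0 a01 Bx By; have /andP[a0 a1] := a01.
have v0 : (0 <= (1 - a) / x)%R by rewrite divr_ge0 ?subr_ge0// ltW.
have w0 : (0 <= a / y)%R by rewrite divr_ge0// ltW.
have u0 : (0 <= x `^ (1 - a) * y `^ a)%R by rewrite mulr_ge0// powR_ge0.
apply: (@le_trans _ _ (\sum_(0 <= n <oo) ((x `^ (1 - a) * y `^ a)%:E *
    (((1 - a) / x)%:E * phi (B n) + (a / y)%:E * L (B n))))).
  by apply: lee_nneseries => // n _; exact: zpow_le_tangent.
rewrite nneseriesZl; last by move=> n _; rewrite adde_ge0// mule_ge0.
rewrite nneseriesD; [|by move=> n _ _; rewrite mule_ge0..].
rewrite !nneseriesZl// -[leRHS]mule1; apply: lee_wpmul2l; first by rewrite lee_fin.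
apply: (@le_trans _ _ (((1 - a) / x)%:E * x%:E + (a / y)%:E * y%:E)).
  by apply: leeD; apply: lee_wpmul2l; rewrite ?lee_fin.
by rewrite -!EFinM -EFinD !divfK ?gt_eqF// subrK.
Qed.

(** * Ergodicity and the exact value of the cost *)

Section dynamics.
Variables S T : X -> X.
Hypotheses (SK : cancel S T) (TK : cancel T S).
Hypothesis mS : forall A, measurable A -> measurable (S @^-1` A).
Hypothesis LS : forall A, measurable A -> L (S @^-1` A) = L A.
Hypothesis L_total : touter T L setT = L setT.
Variable G : set (set X).
Hypothesis GT : forall E, G E -> exists k A, measurable A /\ E = iter k T @^-1` A.
Hypothesis G_recurrent : forall E, measurable E -> <<s G >> (recurrent T E).
Hypothesis L1 : L setT = 1.
Hypothesis L_ergodic : forall E, <<s G >> E -> S @^-1` E = E ->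
  touter T L E = 0 \/ touter T L E = 1.
Implicit Types Q : set X.

Let pphi Q := fine (touter T phi Q).
Let pL Q := fine (touter T L Q).

Let pphiE Q : touter T phi Q = (pphi Q)%:E.
Proof. by rewrite fineK// touter_fin_num. Qed.

Let pLE Q : touter T L Q = (pL Q)%:E.
Proof. by rewrite fineK// touter_fin_num. Qed.

Let pphi_ge0 Q : (0 <= pphi Q)%R.
Proof. by rewrite -lee_fin -pphiE touter_ge0. Qed.

Let pL_ge0 Q : (0 <= pL Q)%R.
Proof. by rewrite -lee_fin -pLE touter_ge0. Qed.

(** Hoelder's bound is applied to a simultaneous cover and [e] tends to 0; the added [e] keeps both
    bounds positive even when a mass vanishes. *)
Lemma touter_zpow_le a Q : (0 <= a <= 1)%R -> <<s G >> Q ->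
  touter T (zpow a) Q <= (pphi Q `^ (1 - a) * pL Q `^ a)%:E.
Proof.
move=> a01 GQ.
apply: (cvge_ge _ (powRM_cvge_addr (pphi_ge0 Q) (pL_ge0 Q) a01)).
near=> e.
have e0 : (0 < e)%R by [].
have [B [QB Bphi BL]] := simultaneous_cover SK TK mS phi LS L_total GT GQ e0.
apply: (le_trans (touter_le_cover _ QB)).
apply: cover_zpow_le => //; first by case: QB.
- by rewrite ltr_wpDl.
- by rewrite ltr_wpDl.
- by rewrite EFinD -pphiE ltW.
- by rewrite EFinD -pLE ltW.
Unshelve. all: by end_near. Qed.

Lemma touter_zpow_le_level a K Q : (0 < K)%R -> (0 < a <= 1)%R ->
  L [set x | K < Z x]%R != 0 ->
  touter T (zpow a) Q <= (K `^ (a - 1) * pL Q)%:E.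
Proof.
move=> K0 /andP[a0 a1]; set E := [set x | K < Z x]%R => LE.
have mE : measurable E by exact: measurable_superlevel.
have a01 : (0 <= a <= 1)%R by rewrite (ltW a0).
set I := recurrent T E; have GI : <<s G >> I by exact: G_recurrent.
have GIC : <<s G >> (~` I) by rewrite -setTD; exact: sigma_algebraCD.
have LIC : touter T L (~` I) = 0.
  (* If the outer measure of [E] were 0, the complement would carry all of the mass by [L_total],
     and [L E] would be 0. *)
  have LE_touter : touter T L E != 0.
    apply: contra LE => /eqP LE0; rewrite -measure_le0.
    have : L setT <= touter T L E + touter T L (~` E).
      by rewrite -L_total -(setUv E); exact: outer_measureU2.
    rewrite LE0 add0e => /le_trans/(_ (touter_measurable T L (measurableC mE))).
    rewrite (measureDI L measurableT mE) setTI setTD.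
    rewrite -[leRHS]adde0 leeD2lE// fin_num_measure//.
    exact: measurableC.
  have LI : touter T L I = 1.
    case: (L_ergodic GI (recurrentS SK E)) => // LI0; case/negP: LE_touter.
    rewrite eq_le touter_ge0 andbT -[leRHS]LI0; apply: (touter_recurrent TK mS) => //.
    by rewrite ltey_eq fin_num_measure.
  have := touter_setC SK TK mS L GT GI; rewrite LI L_total L1.
  rewrite -[leRHS]adde0 leeD2lE// => ?.
  by apply/eqP; rewrite eq_le touter_ge0 andbT.
have QI : touter T (zpow a) Q <=
    touter T (zpow a) (Q `&` I) + touter T (zpow a) (~` I).
  apply: (@le_trans _ _ (touter T (zpow a) ((Q `&` I) `|` ~` I))).
    by apply: le_touter => x Qx; have [] := pselect (I x); [left|right].
  exact: outer_measureU2.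
apply: (le_trans QI); rewrite -[leRHS]adde0; apply: leeD.
  rewrite EFinM -pLE; apply: (touter_setI_recurrent SK TK mS LS) => //.
    by rewrite powR_gt0.
  by move=> D mD DE; exact: zpow_le_above.
(* Off [I] the factor [0 ^ a] vanishes because [a > 0]; for [a = 0] it would be 1. *)
apply: (le_trans (touter_zpow_le a01 GIC)).
by rewrite /pL LIC/= powR0 ?gt_eqF// mulr0.
Qed.

(** The level bound is available for [a > 0] only; continuity carries it to the exponent 0. *)
Lemma touter_phi_le K Q : (0 < K)%R -> L [set x | K < Z x]%R != 0 ->
  touter T (zpow a) Q @[a --> (0 : R)^'+] --> touter T (zpow 0) Q ->
  touter T (zpow 0) Q <= (K^-1 * pL Q)%:E.
Proof.
move=> K0 LK Hcont.
have Kcvg : (K `^ (a - 1) * pL Q)%:E @[a --> (0 : R)^'+] --> (K^-1 * pL Q)%:E.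
  apply: cvg_EFin; first exact: nearW.
  by apply: cvgM; [exact: powR_cvg_exponent|exact: cvg_cst].
rewrite -(cvg_lim _ Hcont)// -(cvg_lim _ Kcvg)//.
apply: lee_lim; [exact: cvgP Hcont|exact: cvgP Kcvg|].
near=> a; apply: touter_zpow_le_level => //; apply/andP; split => //.
by near: a; apply: nbhs_right_le.
Unshelve. all: by end_near. Qed.

Lemma eq_touter (m m' : {measure set X -> \bar R}) Q :
  (forall A, measurable A -> m A = m' A) -> touter T m Q = touter T m' Q.
Proof.
move=> mm'; congr ereal_inf; apply/seteqP.
split=> _ [B [mB QB] <-]; exists B => //; apply: eq_eseriesr => n _;
  by rewrite mm'.
Qed.

Lemma touter_zpow_ge a K Q : (0 < K)%R -> (0 <= a <= 1)%R ->
  L [set x | K < Z x]%R = 0 -> (K `^ (a - 1) * pL Q)%:E <= touter T (zpow a) Q.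
Proof.
move=> K0 a01 LK; apply: le_ereal_inf_tmp => _ [B QB <-]; have [mB _] := QB.
apply: (@le_trans _ _ (\sum_(0 <= n <oo) (K `^ (a - 1))%:E * L (B n))).
  rewrite nneseriesZl// EFinM -pLE; apply: lee_wpmul2l.
    by rewrite lee_fin powR_ge0.
  exact: touter_le_cover.
apply: lee_nneseries => [n _ _|n _]; first by rewrite mule_ge0// lee_fin powR_ge0.
exact: zpow_ge_below.
Qed.

(** When both masses are positive, the ratio [pL Q / pphi Q] takes the place of the essential
    supremum of [Z]: every level above it is [L]-null, and the lower bound at this ratio equals
    Hoelder's upper bound. *)
Theorem touter_zpowE a Q : (0 <= a <= 1)%R -> <<s G >> Q ->
  touter T (zpow a) Q @[a --> (0 : R)^'+] --> touter T (zpow 0) Q ->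
  touter T (zpow a) Q = (pphi Q `^ (1 - a) * pL Q `^ a)%:E.
Proof.
move=> a01 GQ Hcont; have /andP[a0 a1] := a01.
have H0 : touter T (zpow 0) Q = touter T phi Q.
  by apply: eq_touter => A mA; exact: zpow0.
move: a0; rewrite le_eqVlt => /predU1P[<-|a0].
  by rewrite H0 subr0 powRr1// powRr0 mulr1.
move: a1; rewrite le_eqVlt => /predU1P[->|a1].
  rewrite subrr powRr0 mul1r powRr1// -pLE.
  by apply: eq_touter => A mA; exact: zpow1.
apply/eqP; rewrite eq_le touter_zpow_le//=.
have [->|pn0] := eqVneq (pphi Q) 0%R.
  by rewrite powR0 ?subr_eq0 ?gt_eqF// mul0r touter_ge0.
have [->|ln0] := eqVneq (pL Q) 0%R.
  by rewrite powR0 ?gt_eqF// mulr0 touter_ge0.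
have p0 : (0 < pphi Q)%R by rewrite lt0r pn0 pphi_ge0.
have l0 : (0 < pL Q)%R by rewrite lt0r ln0 pL_ge0.
(* A non-null level [K] would give [pphi Q <= pL Q / K] by [touter_phi_le], against the choice of
   [K]. *)
have LK K : (pL Q / pphi Q < K)%R -> L [set x | K < Z x]%R = 0.
  move=> lpK; have K0 : (0 < K)%R by apply: lt_trans lpK; rewrite divr_gt0.
  apply/eqP/negPn/negP => /touter_phi_le -/(_ _ K0 Hcont).
  rewrite H0 pphiE lee_fin mulrC ler_pdivlMr// mulrC -ler_pdivlMr//.
  by rewrite leNgt lpK.
have Hfin : touter T (zpow a) Q \is a fin_num.
  rewrite ge0_fin_numE ?touter_ge0//.
  by apply: le_lt_trans (touter_zpow_le a01 GQ) _; rewrite ltry.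
rewrite -(fineK Hfin) lee_fin; set h := fine _.
set K := (pL Q / pphi Q)%R; have K0 : (0 < K)%R by rewrite divr_gt0.
(* Only levels strictly above the ratio are known to be null, so the lower bound is taken at [K + e]
   and passed to the limit. *)
have lK : (pL Q <= K `^ (1 - a) * h)%R.
  have hcvg : ((K + e) `^ (1 - a) * h)%R @[e --> (0 : R)^'+] --> (K `^ (1 - a) * h)%R.
    apply: cvgM; last exact: cvg_cst.
    by apply: powR_cvg_addr; rewrite ?subr_ge0// ltW.
  rewrite -(cvg_lim _ hcvg)//; apply: limr_ge; first exact: cvgP hcvg.
  near=> e.
  have e0 : (0 < e)%R by [].
  have Ke0 : (0 < K + e)%R by rewrite addr_gt0.
  have : L [set x | K + e < Z x]%R = 0 by apply: LK; rewrite ltrDl.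
  move=> /(touter_zpow_ge Q Ke0 a01).
  rewrite -(fineK Hfin) lee_fin -(opprB 1%R a) powRN mulrC ler_pdivrMr ?powR_gt0//.
  by rewrite mulrC.
have Kp : (0 < K `^ (1 - a))%R by rewrite powR_gt0.
rewrite -(ler_pM2l Kp); apply: le_trans lK.
(* Since [K * pphi Q = pL Q], the left side becomes [pL Q ^ (1 - a) * pL Q ^ a = pL Q]. *)
rewrite mulrA -powRM ?(ltW K0) ?pphi_ge0// divfK ?gt_eqF// -powRD; last first.
  by rewrite ln0 implybT.
by rewrite subrK (powRr1 (pL_ge0 Q)).
Unshelve. all: by end_near. Qed.

End dynamics.
End densities.

(** * Extremal covers *)

Section past_filtration.
Context (X : pointedType) (S T : X -> X) (calA : set (set X)).
Hypotheses (SK : cancel S T) (TK : cancel T S).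

Lemma shiftN n (A : set X) : Defs.shift S (- n%:Z) A = iter n S @^-1` A.
(* At [n = 0] the integer [- 0] is nonnegative, and [shift] takes an image under the identity. *)
Proof. by case: n => // ; rewrite oppr0 /= image_id. Qed.

Lemma shiftP n (A : set X) : Defs.shift S n%:Z A = iter n T @^-1` A.
Proof.
apply/seteqP; split=> x /=; first by case=> y Ay <-; rewrite (iter_can SK).
by move=> Ax; exists (iter n T x) => //; rewrite (iter_can TK).
Qed.

Let X0 : measurableType _ := space0 S calA.

Lemma measurable_preimageS (A : set X0) : measurable A ->
  measurable ((S : X0 -> X0) @^-1` A).
Proof.
move: A; apply: smallest_sub.
  split.
  - by rewrite preimage_set0; exact: measurable0.
  - by move=> A mA; rewrite setTD preimage_setC; exact: measurableC.
  - by move=> F mF; rewrite preimage_bigcup; exact: bigcupT_measurable.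
move=> _ [i [A [AA ->]]]; apply: sub_sigma_algebra.
exists i.+1, A; split => //; rewrite !shiftN.
by apply/seteqP; split=> x /=; rewrite -iterSr.
Qed.

Lemma measurable_calA (A : set X) : calA A -> measurable (A : set X0).
Proof.
move=> AA; apply: sub_sigma_algebra; exists 0%N, A; split => //.
by rewrite shiftN.
Qed.

Lemma full_genP (E : set X) : full_gen S calA E ->
  exists k (A : set X0), measurable A /\ E = iter k (T : X0 -> X0) @^-1` A.
Proof.
move=> [[n|n] [A [AA ->]]].
  exists 0%N, (iter n S @^-1` A); split; last exact: shiftN.
  by apply: measurable_iterS; [exact: measurable_preimageS|exact: measurable_calA].
exists n.+1, A; split; first exact: measurable_calA.
by rewrite NegzE opprK shiftP.
Qed.

Lemma sigmaB_iter n (A : set X0) : measurable A ->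
  sigmaB S calA (iter n T @^-1` A).
Proof.
move: A; apply: smallest_sub.
  split.
  - by rewrite preimage_set0; exact: sigma_algebra0.
  - move=> A mA; rewrite setTD preimage_setC -setTD; exact: sigma_algebraCD.
  - by move=> F mF; rewrite preimage_bigcup; exact: sigma_algebra_bigcup.
move=> _ [i [A [AA ->]]]; apply: sub_sigma_algebra.
exists (i%:Z - n%:Z), A; split => //; rewrite shiftN.
have [ni|/ltnW ni] := leqP n i.
  rewrite subzn// shiftN; apply/seteqP.
  by split=> x /=; rewrite (iter_can_ge TK).
rewrite opprB subzn// shiftP; apply/seteqP.
by split=> x /=; rewrite (iter_can_le TK).
Qed.

Lemma sigmaB_recurrent (A : set X0) : measurable A ->
  sigmaB S calA (recurrent (T : X0 -> X0) A).
Proof.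
move=> mA.
have -> : recurrent (T : X0 -> X0) A = \bigcap_k \bigcup_(n in [set n | (k <= n)%N])
    (iter n T @^-1` A).
  apply/seteqP; split=> x rx k => [_|].
    by have [n [kn An]] := rx k; exists n.
  by have [n kn An] := rx k I; exists n.
pose B0 : measurableType _ := g_sigma_algebraType (full_gen S calA).
apply: (@bigcapT_measurable _ B0) => k.
apply: (@bigcup_measurable _ B0) => n _.
exact: sigmaB_iter.
Qed.

(** Pulling [A_{-n}] back by the [n]-th iterate of [S] lands in [A_0]; [tcovers_covers] goes the
    other way. *)
Lemma covers_tcovers (Q : set X) A : covers S calA Q A ->
  tcovers (T : X0 -> X0) Q (fun n => Defs.shift S (- n%:Z) (A n)).
Proof.
move=> [mA QA]; split=> [n|x /QA[n _ Ax]].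
  have [B mB <-] := mA n; rewrite opprK shiftN shiftP.
  by rewrite (_ : _ @^-1` _ = B)//; apply/seteqP; split=> x /=; rewrite (iter_can SK).
by exists n; rewrite shiftN /= (iter_can TK).
Qed.

Lemma tcovers_covers (Q : set X) B : tcovers (T : X0 -> X0) Q B ->
  covers S calA Q (fun n => iter n T @^-1` B n).
Proof.
move=> [mB QB]; split=> [n|x /QB[n Bn]]; last by exists n.
by exists (B n); [exact: mB|rewrite opprK shiftP].
Qed.

Lemma shift_preimage n (B : set X) :
  Defs.shift S (- n%:Z) (iter n T @^-1` B) = B.
Proof.
by rewrite shiftN; apply/seteqP; split=> x /=; rewrite (iter_can SK).
Qed.

Lemma dyn_outerE (R : realType) (nu : set X -> \bar R) Q :
  dyn_outer S calA nu Q = touter (T : X0 -> X0) nu Q.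
Proof.
congr ereal_inf; apply/seteqP; split=> _ [B QB <-].
  exists (fun n => Defs.shift S (- n%:Z) (B n)) => //; exact: covers_tcovers.
exists (fun n => iter n T @^-1` B n); first exact: tcovers_covers.
by apply: eq_eseriesr => n _; rewrite shift_preimage.
Qed.

End past_filtration.

(** * Evaluation of the constrained infima and of the supremum *)

Section extremal_covers.
Context (R : realType) (X : pointedType) (S T : X -> X) (calA : set (set X)).
Hypotheses (SK : cancel S T) (TK : cancel T S).
Variables phi0 Lambda : {finite_measure set (space0 S calA) -> \bar R}.
Hypothesis Lambda_inv : forall B : set X, sigmaA0 S calA B ->
  Lambda (S @^-1` B) = Lambda B.
Variable Z : X -> R.
Hypothesis Z_ge0 : forall x, 0 <= Z x.
Hypothesis Z_meas : measurable_fun setT (Z : space0 S calA -> R).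
Hypothesis Z_density : forall B : set (space0 S calA), measurable B ->
  Lambda B = (\int[phi0]_(x in B) (Z x)%:E)%E.
Hypothesis Lambda_prob : Lambda setT = 1%E.
Hypothesis Lambda_ergodic :
  ergodic_probability S (sigmaB S calA) (dyn_outer S calA Lambda).
Variable Q : set X.
Hypothesis Q_B : sigmaB S calA Q.
Hypothesis H_cont0 : calH phi0 Z a Q @[a --> within `[0, 1] (nbhs (0 : R))]
  --> calH phi0 Z 0 Q.
Local Open Scope ereal_scope.

Let p := fine (dyn_outer S calA phi0 Q).
Let l := fine (dyn_outer S calA Lambda Q).
Let h a : R := (p `^ (1 - a) * l `^ a)%R.
Let u a e : R := ((p + e) `^ (1 - a) * (l + e) `^ a)%R.

Let phi0E : dyn_outer S calA phi0 Q = p%:E.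
Proof. by rewrite /p (dyn_outerE calA SK TK) fineK// touter_fin_num. Qed.

Let LambdaE : dyn_outer S calA Lambda Q = l%:E.
Proof. by rewrite /l (dyn_outerE calA SK TK) fineK// touter_fin_num. Qed.

Let p0 : (0 <= p)%R.
Proof. by rewrite /p (dyn_outerE calA SK TK) fine_ge0// touter_ge0. Qed.

Let l0 : (0 <= l)%R.
Proof. by rewrite /l (dyn_outerE calA SK TK) fine_ge0// touter_ge0. Qed.

Let L_total : touter (T : space0 S calA -> space0 S calA) Lambda setT = Lambda setT.
Proof.
by rewrite -(dyn_outerE calA SK TK) Lambda_prob; have [] := Lambda_ergodic.
Qed.

Let cvg_u a : (0 <= a <= 1)%R -> (u a e)%:E @[e --> (0 : R)^'+] --> (h a)%:E.
Proof. exact: powRM_cvge_addr. Qed.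

Lemma calHE a : (0 <= a <= 1)%R -> calH phi0 Z a Q = (h a)%:E.
Proof.
move=> a01.
have calH_touter b : calH phi0 Z b Q =
    touter (T : space0 S calA -> space0 S calA) (zpow phi0 Z b) Q.
  exact: (dyn_outerE calA SK TK).
rewrite calH_touter /h /p /l !(dyn_outerE calA SK TK).
have erg (E : set X) : <<s full_gen S calA >> E -> S @^-1` E = E ->
    touter (T : space0 S calA -> space0 S calA) Lambda E = 0 \/
    touter (T : space0 S calA -> space0 S calA) Lambda E = 1.
  move=> BE SE; rewrite -!(dyn_outerE calA SK TK).
  by have [_] := Lambda_ergodic; apply.
apply: (@touter_zpowE _ (space0 S calA) R phi0 Lambda Z Z_ge0 Z_meas Z_density
  S T SK TK (measurable_preimageS (calA := calA)) Lambda_inv L_total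
  (full_gen S calA) (full_genP SK TK) (sigmaB_recurrent SK TK) Lambda_prob
  erg a Q a01 Q_B).
rewrite -calH_touter => P /H_cont0 /near_at_right_within01.
by apply: filterS => b; rewrite /preimage /= calH_touter.
Qed.

Let covers_measurable A : covers S calA Q A ->
  forall n, measurable (Defs.shift S (- n%:Z) (A n) : set (space0 S calA)).
Proof. by move=> /(covers_tcovers SK TK) []. Qed.

Let calH_le a A : covers S calA Q A ->
  calH phi0 Z a Q <= cover_sum S (int_Zpow phi0 Z a) A.
Proof. by move=> QA; apply: ereal_inf_lbound; exists A. Qed.

Let cover_sum1 A : covers S calA Q A ->
  cover_sum S (int_Zpow phi0 Z 1) A = cover_sum S Lambda A.
Proof.
move=> /covers_measurable mA; apply: eq_eseriesr => n _.
exact: (@zpow1 _ (space0 S calA) R phi0 Lambda Z Z_ge0 Z_density _ (mA n)).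
Qed.

(** Near-optimality is asked for the extreme exponents 0 and 1; by [near_opt_le] and [calHE] it
    forces near-optimality for all exponents between them. *)
Definition near_opt (e : R) : set (nat -> set X) :=
  [set A | [/\ covers S calA Q A, cover_sum S phi0 A < (p + e)%:E &
    cover_sum S Lambda A < (l + e)%:E]].

Lemma near_opt_nonempty e : (0 < e)%R -> near_opt e !=set0.
Proof.
move=> e0.
have [B [QB Bp Bl]] := @simultaneous_cover _ (space0 S calA) R S T SK TK
  (measurable_preimageS (calA := calA)) phi0 Lambda Lambda_inv L_total
  (full_gen S calA) Q e (full_genP SK TK) Q_B e0.
exists (fun n => iter n T @^-1` B n); split; first exact: (tcovers_covers SK TK).
- rewrite EFinD -phi0E (dyn_outerE calA SK TK); apply: le_lt_trans Bp.
  by apply: lee_nneseries => // n _; rewrite (shift_preimage SK).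
- rewrite EFinD -LambdaE (dyn_outerE calA SK TK); apply: le_lt_trans Bl.
  by apply: lee_nneseries => // n _; rewrite (shift_preimage SK).
Qed.

Lemma near_opt_le a e A : (0 <= a <= 1)%R -> (0 < e)%R -> near_opt e A ->
  cover_sum S (int_Zpow phi0 Z a) A <= (u a e)%:E.
Proof.
move=> a01 e0 [QA Ap Al].
apply: (@cover_zpow_le _ (space0 S calA) R phi0 Lambda Z Z_ge0 Z_meas Z_density _ _ _
  _ (covers_measurable QA)) => //.
- by rewrite ltr_wpDl.
- by rewrite ltr_wpDl.
- exact: ltW.
- exact: ltW.
Qed.

(** Over any family of covers of [Q] the infimum is at least [calH]; if the family contains
    [near_opt e] for all small [e], it is at most the limit of [u a e]. *)
Lemma inf_near_optE (P : set (nat -> set X)) a : (0 <= a <= 1)%R ->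
  P `<=` covers S calA Q -> (\forall e \near (0 : R)^'+, near_opt e `<=` P) ->
  ereal_inf [set cover_sum S (int_Zpow phi0 Z a) A | A in P] = (h a)%:E.
Proof.
move=> a01 PQ nP; apply/eqP; rewrite eq_le; apply/andP; split; last first.
  by apply: le_ereal_inf_tmp => _ [A /PQ/calH_le QA <-]; rewrite -calHE.
apply: (cvge_ge _ (cvg_u a01)); near=> e.
have e0 : (0 < e)%R by [].
have [A nA] := near_opt_nonempty e0.
apply: le_trans (near_opt_le a01 e0 nA); apply: ereal_inf_lbound.
exists A => //; move: A nA; near: e; exact: nP.
Unshelve. all: by end_near. Qed.

Let near_u_lt a e : (0 <= a <= 1)%R -> (0 < e)%R ->
  \forall d \near (0 : R)^'+, (u a d < h a + e)%R.
Proof.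
move=> a01 e0; apply: (cvgr_lt (h a)); last by rewrite ltrDl.
exact: powRM_cvg_addr.
Qed.

Let near_opt_near_covers b e : (0 <= b <= 1)%R -> (0 < e)%R ->
  \forall d \near (0 : R)^'+, near_opt d `<=` near_covers phi0 Z b e Q.
Proof.
move=> b01 e0; near=> d => A nA; split; first by case: nA.
have d0 : (0 < d)%R by [].
apply: le_lt_trans (near_opt_le b01 d0 nA) _.
by rewrite calHE// -EFinD lte_fin; near: d; exact: near_u_lt.
Unshelve. all: by end_near. Qed.

(** The infimum equals [h a] for every [e > 0] already, so the limit is that of a constant. *)
Lemma calH2E a b : (0 <= a <= 1)%R -> (0 <= b <= 1)%R ->
  calH2 phi0 Z a b Q = (h a)%:E.
Proof.
move=> a01 b01; apply: lim_near_cst => //; near=> e.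
apply: inf_near_optE => //; first by move=> A [].
by apply: near_opt_near_covers.
Unshelve. all: by end_near. Qed.

Let a01_0 : ((0 : R) <= 0 <= (1 : R))%R.
Proof. by rewrite lexx ler01. Qed.

Let a01_1 : ((0 : R) <= 1 <= (1 : R))%R.
Proof. by rewrite lexx ler01. Qed.

Lemma calH3E a b : (0 <= a <= 1)%R -> (0 <= b <= 1)%R ->
  calH3 phi0 Z a b Q = (h a)%:E.
Proof.
move=> a01 b01; apply: lim_near_cst => //; near=> e.
have e0 : (0 < e)%R by [].
apply: inf_near_optE => //; first by move=> A [[]].
apply: filterS2 (near_opt_near_covers a01_0 e0) (near_opt_near_covers b01 e0).
move=> d nd0 ndb A nA; split; first exact: nd0.
by have [_] := ndb _ nA; rewrite calHE// calH2E.
Unshelve. all: by end_near. Qed.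

(** The class [near_covers_01 e Q] coincides with [near_opt e], because the infima in its definition
    are [l] and [p]; hence the supremum lies between [h a] and [u a e]. *)
Lemma calJE a : (0 <= a <= 1)%R -> calJ phi0 Z a Q = (h a)%:E.
Proof.
move=> a01; apply: cvg_lim => //.
apply: (squeeze_cvge _ (cvg_cst _) (cvg_u a01)); near=> e.
have e0 : (0 < e)%R by [].
apply/andP; split.
  have [A nA] := near_opt_nonempty e0.
  have QA : covers S calA Q A by case: nA.
  apply: (@le_trans _ _ (cover_sum S (int_Zpow phi0 Z a) A)).
    by rewrite -calHE//; exact: calH_le.
  apply: ereal_sup_ubound; exists A => //; case: nA => _ Ap Al; split.
    split=> //; rewrite cover_sum1// calHE// /h subrr powRr0 mul1r powRr1//.
  by rewrite calH2E// /h subr0 powRr0 mulr1 powRr1.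
apply: ge_ereal_sup => _ [A [[QA Al] Ap] <-]; apply: near_opt_le => //; split=> //.
  by move: Ap; rewrite calH2E// /h subr0 powRr0 mulr1 powRr1.
by move: Al; rewrite cover_sum1// calHE// /h subrr powRr0 mul1r powRr1.
Unshelve. all: by end_near. Qed.

Lemma extremal_coversE a b c : (0 <= a <= 1)%R -> (0 <= b <= 1)%R -> (0 <= c <= 1)%R ->
  [/\ calH phi0 Z a Q = calH2 phi0 Z a b Q,
      calH2 phi0 Z a b Q = calH3 phi0 Z a c Q,
      calH3 phi0 Z a c Q = calJ phi0 Z a Q &
      calJ phi0 Z a Q
        = (dyn_outer S calA phi0 Q) `^ (1 - a) * (dyn_outer S calA Lambda Q) `^ a].
Proof.
by move=> a01 b01 c01; rewrite calHE// calH2E// calH3E// calJE// phi0E LambdaE.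
Qed.

End extremal_covers.

Unset Implicit Arguments.

Theorem corollary11 (R : realType) (X : pointedType) (S : X -> X)
    (S_bij : bijective S)
    (calA : set (set X)) (calA_sigma : sigma_algebra setT calA)
    (phi0 Lambda : {finite_measure set (space0 S calA) -> \bar R})
    (Lambda_inv : forall B : set X, sigmaA0 S calA B ->
       Lambda (S @^-1` B) = Lambda B)
    (Lambda_ac : Lambda `<< phi0)
    (Z : X -> R)
    (Z_ge0 : forall x, 0 <= Z x)
    (Z_meas : measurable_fun setT (Z : space0 S calA -> R))
    (Z_density : forall B : set (space0 S calA), measurable B ->
       Lambda B = (\int[phi0]_(x in B) (Z x)%:E)%E)
    (Lambda_prob : Lambda setT = 1%E)
    (Lambda_ergodic :
       ergodic_probability S (sigmaB S calA) (dyn_outer S calA Lambda))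
    (Q : set X) (Q_B : sigmaB S calA Q)
    (H_cont0 : calH phi0 Z a Q @[a --> within `[0, 1] (nbhs (0 : R))]
                 --> calH phi0 Z 0 Q)
    (alpha alpha0 beta : R)
    (alpha01 : 0 <= alpha <= 1)
    (alpha001 : 0 <= alpha0 <= 1)
    (beta01 : 0 <= beta <= 1) :
  [/\ calH phi0 Z alpha Q = calH2 phi0 Z alpha alpha0 Q,
      calH2 phi0 Z alpha alpha0 Q = calH3 phi0 Z alpha beta Q,
      calH3 phi0 Z alpha beta Q = calJ phi0 Z alpha Q &
      calJ phi0 Z alpha Q
        = ((dyn_outer S calA phi0 Q) `^ (1 - alpha)
           * (dyn_outer S calA Lambda Q) `^ alpha)%E].
Proof.
have [T SK TK] := S_bij.
exact: (extremal_coversE SK TK).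
Qed.
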